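(* For every $\epsilon\in(0,\tfrac23)$ there exists a constant $c>0$ (depending only on $\epsilon$) such that the following holds. Let $n,k,m$ be positive integers with $k\le n^{\frac23-\epsilon}$ and $m\le c\,k^{1.5}$. Let $A=(a_{i,j})\in\{\pm1\}^{m\times n}$, where the $a_{i,j}$ are independent Rademacher random variables. Then, with probability at least $\frac12$, $A$ is not a valid universal $1$-bit measurement matrix for support recovery on $\mathcal{X}_k(1)$.
   Context: A Rademacher random variable equals $+1$ or $-1$ with probability $1/2$ each. The function $\mathrm{sign}(\cdot)$ is applied entrywise, with values in $\{-1,1\}$ and the convention $\mathrm{sign}(0)=1$. For $x\in\mathbb{R}^n$, $\mathrm{supp}(x)$ is the set of indices of nonzero entries and $\|x\|_0=|\mathrm{supp}(x)|$. For $R\ge 1$, $\mathcal{X}_k(R)$ is the set of (nonzero) $x \in \mathbb{R}^n$ with $\|x\|_0\le k$ and $\frac{\max_{i\in \mathrm{supp}(x)}|x_i|}{\min_{i\in \mathrm{supp}(x)}|x_i|}\le R$ (here $R=1$). A matrix $A\in\mathbb{R}^{m\times n}$ is a valid universal $1$-bit measurement matrix for support recovery on $\mathcal{X}_k(R)$ if and only if for all $u,v\in\mathcal{X}_k(R)$, $\mathrm{supp}(u)\ne \mathrm{supp}(v)$ implies $\mathrm{sign}(Au)\neq \mathrm{sign}(Av)$. *)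

(* Defs.v *)
(* MathComp + MathComp-Analysis. *)
From HB Require Import structures.
From mathcomp Require Import all_boot all_order all_algebra.
From mathcomp Require Import all_classical all_reals all_analysis.
Set Implicit Arguments.
Unset Strict Implicit.
Unset Printing Implicit Defensive.
Import Order.TTheory GRing.Theory Num.Theory.
Import numFieldNormedType.Exports.
Local Open Scope ring_scope.

Section OneBit.
Variable R : realType.

(* Unlike [Num.sg], the value at 0 is 1. *)
Definition sign1 (t : R) : R := if 0 <= t then 1 else -1.

Definition signv (m : nat) (y : 'cV[R]_m) : 'cV[R]_m := map_mx sign1 y.

Definition supp (n : nat) (x : 'cV[R]_n) : {set 'I_n} :=
  [set i | x i 0 != 0]%SET.

Definition norm0 (n : nat) (x : 'cV[R]_n) : nat := #|supp x|.

(* The default value 0 is harmless for x != 0, since all the terms are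
   positive. *)
Definition max_supp (n : nat) (x : 'cV[R]_n) : R :=
  \big[Num.max/0]_(i in supp x) `|x i 0|.

(* The default value [max_supp x] is an upper bound of all the terms, so that
   for x != 0 this is the minimum over the (nonempty) support. *)
Definition min_supp (n : nat) (x : 'cV[R]_n) : R :=
  \big[Num.min/max_supp x]_(i in supp x) `|x i 0|.

Definition sparse_set (n k : nat) (rho : R) : set 'cV[R]_n :=
  [set x | [/\ x != 0, (norm0 x <= k)%N & max_supp x / min_supp x <= rho]]%classic.

Definition valid_universal_1bit (m n k : nat) (rho : R) (A : 'M[R]_(m, n)) : Prop :=
  forall u v : 'cV[R]_n, sparse_set k rho u -> sparse_set k rho v ->
    supp u != supp v -> signv (A *m u) <> signv (A *m v).

End OneBit.

Section RandomVariables.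
Context (d : measure_display) (T : measurableType d) (R : realType)
  (P : probability T R).

(* The values 1 and -1 are taken surely, not only almost surely, so that a
   matrix of such variables is everywhere a sign matrix. *)
Definition rademacher (X : {RV P >-> R}) : Prop :=
  [/\ forall w, X w = 1 \/ X w = -1,
      P (X @^-1` [set 1])%classic = (1 / 2)%:E
    & P (X @^-1` [set -1])%classic = (1 / 2)%:E].

Definition mutually_independent (I : finType) (X : I -> {RV P >-> R}) : Prop :=
  forall (J : {set I}) (B : I -> set R), (forall i, measurable (B i)) ->
    P (\bigcap_(i in [set` J]) (X i @^-1` B i))%classic
    = (\prod_(i in J) P (X i @^-1` B i)%classic)%E.

Definition random_matrix (m n : nat) (a : 'I_m -> 'I_n -> {RV P >-> R}) (w : T) :
  'M[R]_(m, n) := \matrix_(i, j) a i j w.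

End RandomVariables.

(* Main.v *)
(* Let W be a set of 2N < k columns. If a sign vector x supported on W satisfies
   <a_i, x> <> 0 for every row a_i, then |<a_i, x>| >= 2 by parity, so adding a
   coordinate 1 outside W to x changes the support but not the signs. Such an
   x exists with probability at least 1/2 by the second moment method: the
   probability that a row is orthogonal to x is of order N^(-1/2), and two
   typical sign vectors have normalized overlap of order N^(-1/2), which makes
   the events nearly independent as long as m = O(N^(3/2)). The parity of the
   number of +1 entries of a row decides whether the row can be orthogonal to
   an x with evenly many +1 entries at all; this correlates all the events, and
   is removed by giving the rows of the two parities different weights. *)

Require Import Defs.
From HB Require Import structures.
From mathcomp Require Import all_boot all_order all_algebra.
From mathcomp Require Import all_classical all_reals all_analysis.
From mathcomp Require Import ring lra zify.
Set Implicit Arguments.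
Unset Strict Implicit.
Unset Printing Implicit Defensive.
Import Order.TTheory GRing.Theory Num.Theory.
Import numFieldNormedType.Exports.
Local Open Scope ring_scope.

(** * Central binomial coefficients *)

Section CentralBinomial.
Variable R : realType.

(** The probability that a uniformly random subset of a set of size [2 N] has exactly [N]
    elements. *)
Definition cbin (N : nat) : R := 'C(N.*2, N)%:R / 4 ^+ N.

Lemma cbin0 : cbin 0 = 1.
Proof. by rewrite /cbin bin0 expr0 divr1. Qed.

Lemma cbinS N : cbin N.+1 = cbin N * (N.*2.+1)%:R / (N.*2.+2)%:R.
Proof.
have e : ('C(N.+1.*2, N.+1) * N.+1 = 'C(N.*2, N) * N.*2.+1 * 2)%N.
  have h1 := mul_bin_diag N.*2.+2 N.
  have h2 := mul_bin_down N.*2.+1 N.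
  rewrite /= in h1 h2; rewrite doubleS.
  have h3 : (N.*2.+1 - N = N.+1)%N by lia.
  rewrite h3 in h2; nia.
have {}e : 'C(N.+1.*2, N.+1)%:R * N.+1%:R = 'C(N.*2, N)%:R * N.*2.+1%:R * 2 :> R.
  by rewrite -!natrM e.
rewrite /cbin exprS.
have n0 : N.+1%:R != 0 :> R by rewrite pnatr_eq0.
have -> : N.*2.+2%:R = N.+1%:R * 2 :> R by rewrite -natrM muln2 doubleS.
have p0 : (4 : R) ^+ N != 0 by rewrite expf_neq0// pnatr_eq0.
apply: (mulIf n0); rewrite mulrAC e.
by field; rewrite p0 nat1r n0.
Qed.

Lemma cbin_gt0 N : 0 < cbin N.
Proof. by rewrite divr_gt0 ?exprn_gt0// ltr0n bin_gt0 -addnn leq_addr. Qed.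

(** With [y = 2 N + 1], the induction step amounts to [y (y + 2) <= (y + 1)^2]. *)
Lemma cbin_sqr_le N : cbin N ^+ 2 * (N.*2.+1)%:R <= 1.
Proof.
elim: N => [|N IH]; first by rewrite cbin0 expr1n mul1r.
apply: le_trans IH; rewrite cbinS doubleS.
have -> : N.*2.+3%:R = N.*2.+1%:R + 2 :> R by rewrite -!natr1; ring.
have -> : N.*2.+2%:R = N.*2.+1%:R + 1 :> R by rewrite -!natr1; ring.
have : (1 : R) <= N.*2.+1%:R by rewrite ler1n.
move: (N.*2.+1%:R) => y y1.
rewrite [leLHS](_ : _ = cbin N ^+ 2 * (y ^+ 2 * (y + 2) / (y + 1) ^+ 2)); last first.
  by field; lra.
rewrite ler_wpM2l ?sqr_ge0// ler_pdivrMr; last by rewrite exprn_gt0//; lra.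
nra.
Qed.

Lemma cbin_sqr_le_inv N : (0 < N)%N -> cbin N ^+ 2 <= N%:R^-1.
Proof.
move=> N0; have h := cbin_sqr_le N.
rewrite -[leRHS]mul1r ler_pdivlMr ?ltr0n//; apply: le_trans h.
by rewrite ler_wpM2l ?sqr_ge0// ler_nat; lia.
Qed.

(* Having no constant factor on the right matters: it makes the excess of
   [cbin a * cbin (N - a)] over [2 * cbin N ^+ 2] quadratic in [2 a - N]. *)
Lemma cbin_sqr_mul_mono a N : (a <= N)%N ->
  cbin a ^+ 2 * a%:R <= cbin N ^+ 2 * N%:R.
Proof.
elim: N => [|N IH]; first by rewrite leqn0 => /eqP ->.
rewrite leq_eqVlt => /predU1P[->//|/IH h]; apply: le_trans h _.
rewrite cbinS.
have -> : N.*2.+2%:R = 2 * N%:R + 2 :> R by rewrite -!natr1 -mul2n natrM; ring.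
have -> : N.*2.+1%:R = 2 * N%:R + 1 :> R by rewrite -!natr1 -mul2n natrM; ring.
have -> : N.+1%:R = N%:R + 1 :> R by rewrite natr1.
have : (0 : R) <= N%:R by rewrite ler0n.
move: (N%:R) => y y0.
rewrite [leRHS](_ : _ = cbin N ^+ 2 * ((2 * y + 1) ^+ 2 / (4 * (y + 1)))); last first.
  by field; lra.
rewrite ler_wpM2l ?sqr_ge0// ler_pdivlMr; last lra.
nra.
Qed.

Lemma cbin_le1 N : cbin N <= 1.
Proof.
have h := cbin_sqr_le N.
have : cbin N ^+ 2 <= 1.
  apply: le_trans h; rewrite ler_peMr ?sqr_ge0// ler1n//.
by rewrite -[X in _ <= X -> _](expr1n _ 2) ler_sqr ?nnegrE ?ler01// ltW// cbin_gt0.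
Qed.

Lemma exprn_bin_le (x y : R) (n j : nat) : 0 <= x -> 0 <= y -> (j <= n)%N ->
  x ^+ (n - j) * y ^+ j * 'C(n, j)%:R <= (x + y) ^+ n.
Proof.
move=> x0 y0 jn; rewrite exprDn (bigD1 (Ordinal (jn : (j < n.+1)%N)))//=.
rewrite mulr_natr lerDl sumr_ge0// => i _.
by rewrite mulrn_wge0// mulr_ge0// exprn_ge0.
Qed.

(** This is [e^(-z) >= 1 - z] at [z = x / (1 + x)], inverted. *)
Lemma expR_frac_le (x : R) : -1 < x -> expR (x / (1 + x)) <= 1 + x.
Proof.
move=> x1; have x0 : 0 < 1 + x by lra.
have := expR_ge1Dx (- (x / (1 + x))).
rewrite expRN (_ : 1 - _ = (1 + x)^-1); last by field; lra.
by rewrite lef_pV2 // posrE ?expR_gt0.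
Qed.

(** A Chernoff bound, obtained from a single term of the expansion of
    [((1 - t) + (1 + t))^(2 N) = 4^N]. *)
Let bin_gauss_half (N s : nat) : (0 < N)%N -> (s <= N)%N ->
  'C(N.*2, N + s)%:R / 4 ^+ N <= expR (- (s%:R ^+ 2 / (2 * N%:R))) :> R.
Proof.
move=> N0 sN.
have n0 : 0 < N%:R :> R by rewrite ltr0n.
(* With the crude bound of [expR_frac_le] the exponent is [2 t (s - N t) / (1 - t^2)]; this [t]
   maximizes the numerator. *)
pose t : R := s%:R / (2 * N%:R).
have t0 : 0 <= t by rewrite divr_ge0// mulr_ge0// ltW.
have t1 : t <= 1 / 2.
  by rewrite ler_pdivrMr ?mulr_gt0// mulrA mul1r mulVf// mul1r ler_nat.
have := @exprn_bin_le (1 - t) (1 + t) N.*2 (N + s).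
have -> : (N.*2 - (N + s) = N - s)%N by lia.
have -> : 1 - t + (1 + t) = 2 by ring.
rewrite -(mul2n N) exprM -[2 ^+ 2]natrX => h.
have {}h := h ltac:(lra) ltac:(lra) ltac:(lia).
have h1 := @expR_frac_le t; have h2 := @expR_frac_le (- t).
have e1 : expR (t / (1 + t) * (N + s)%:R) <= (1 + t) ^+ (N + s).
  rewrite mulrC expRM_natl; apply: lerXn2r; rewrite ?nnegrE ?expR_ge0//; [lra|].
  by apply: h1; lra.
have e2 : expR (- t / (1 - t) * (N - s)%:R) <= (1 - t) ^+ (N - s).
  rewrite mulrC expRM_natl; apply: lerXn2r; rewrite ?nnegrE ?expR_ge0//; [lra|].
  by apply: h2; lra.
have e3 : expR (s%:R ^+ 2 / (2 * N%:R)) <= (1 - t) ^+ (N - s) * (1 + t) ^+ (N + s).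
  apply: le_trans (ler_pM (expR_ge0 _) (expR_ge0 _) e2 e1).
  rewrite -expRD ler_expR.
  have es : s%:R = 2 * N%:R * t by rewrite /t mulrC divfK// gt_eqF// mulr_gt0.
  rewrite natrB// natrD es.
  rewrite [leLHS](_ : _ = 2 * N%:R * t ^+ 2); last by field; rewrite gt_eqF.
  rewrite [leRHS](_ : _ = 2 * N%:R * t ^+ 2 / (1 - t ^+ 2)); last first.
    by field; nra.
  rewrite ler_pdivlMr; last nra.
  have : 0 <= N%:R * t ^+ 2 by rewrite mulr_ge0 ?sqr_ge0// ltW.
  nra.
rewrite expRN ler_pdivrMr ?exprn_gt0// mulrC ler_pdivlMr ?expR_gt0// mulrC.
by apply: le_trans h; rewrite ler_wpM2r.
Qed.

Lemma bin_gauss (N j : nat) : (0 < N)%N -> (j <= N.*2)%N ->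
  'C(N.*2, j)%:R / 4 ^+ N <= expR (- ((j%:R - N%:R) ^+ 2 / (2 * N%:R))) :> R.
Proof.
move=> N0 j2; have [jN|jN] := leqP N j.
  have := @bin_gauss_half N (j - N) N0; rewrite subnKC// natrB//; apply; lia.
have := @bin_gauss_half N (N - j) N0 (leq_subr _ _).
have -> : (N + (N - j) = N.*2 - j)%N by lia.
by rewrite bin_sub// natrB ?(ltnW jN)// -sqrrN opprB.
Qed.

End CentralBinomial.

(** * Moments of a pair of sign vectors *)

Section MomentBound.
Variable R : realType.
Local Notation cbin := (@cbin R).

(** Multiply the bounds of [cbin_sqr_mul_mono] for [a] and [b], and use [4 a b = (a + b)^2 (1 - x)].
    For [x <= 1 / 2] the resulting factor [1 / (1 - x)] is at most [(1 + x)^2]. *)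
Lemma cbin_prod_le (a b : nat) : (0 < a + b)%N ->
  let x := ((a%:R - b%:R) / (a + b)%:R) ^+ 2 in x <= 1 / 2 ->
  cbin a * cbin b <= 2 * cbin (a + b) ^+ 2 * (1 + x).
Proof.
move=> N0 x x2.
have n0 : 0 < (a + b)%:R :> R by rewrite ltr0n.
have hA := @cbin_sqr_mul_mono R a (a + b) (leq_addr _ _).
have hB := @cbin_sqr_mul_mono R b (a + b) (leq_addl _ _).
have x0 : 0 <= x by rewrite sqr_ge0.
have eab : 4 * (a%:R * b%:R) = (a + b)%:R ^+ 2 * (1 - x).
  by rewrite /x natrD; field; rewrite -natrD gt_eqF.
have AB : (cbin a * cbin b) ^+ 2 * (1 - x) <= 4 * (cbin (a + b) ^+ 2) ^+ 2.
  have := ler_pM _ _ hA hB; rewrite !mulr_ge0 ?sqr_ge0// => /(_ isT isT) h.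
  rewrite -(@ler_pM2r _ ((a + b)%:R ^+ 2)) ?exprn_gt0//.
  rewrite [leLHS](_ : _ = 4 * (cbin a ^+ 2 * a%:R * (cbin b ^+ 2 * b%:R))).
    by apply: le_trans (ler_wpM2l _ h) _ => //; lra.
  have -> : forall u v : R, u * (1 - x) * v = u * (v * (1 - x)) by move=> *; ring.
  by rewrite -eab; ring.
have l0 : 0 <= cbin a * cbin b by rewrite mulr_ge0// ltW// cbin_gt0.
have r0 : 0 <= 2 * cbin (a + b) ^+ 2 * (1 + x) by rewrite !mulr_ge0 ?sqr_ge0//; lra.
rewrite -ler_sqr ?nnegrE// -(@ler_pM2r _ (1 - x)); last lra.
apply: le_trans AB _.
have : 0 <= (cbin (a + b) ^+ 2) ^+ 2 by rewrite sqr_ge0.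
set P := (cbin (a + b) ^+ 2) ^+ 2 => P0.
rewrite [leRHS](_ : _ = 4 * P * ((1 + x) ^+ 2 * (1 - x))); last by rewrite /P; ring.
rewrite ler_peMr//; [lra|nra].
Qed.

(* [2 * cbin N] is the probability that a row of the critical parity is
   orthogonal to a given even sign vector. *)
Definition weight (N : nat) : R := (1 - 2 * cbin N)^-1.

(* The mean of the product of the weights of a row against two even sign
   vectors that differ in [2 a] coordinates. *)
Definition pair_moment (N a : nat) : R :=
  1 + weight N ^+ 2 * (cbin a * cbin (N - a) - 2 * cbin N ^+ 2).

(** * Powers of the pair moment for large [N], with [s] the square root of [N] *)

Section Large.
Variables (N : nat) (s : R).
Hypotheses (s_ge : 1024 <= s) (sqr_s : s ^+ 2 = N%:R).

Let s_gt0 : 0 < s.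
Proof. by move: s_ge; lra. Qed.

Let N_gt0 : (0 < N)%N.
Proof. by rewrite -(ltr0n R) -sqr_s exprn_gt0. Qed.

(** In [cbin_sqr_le], [2 n + 1 >= N] is enough; so the bound covers the larger of [a] and
    [N - a]. *)
Lemma cbin_le_inv_sqrt (n : nat) : (N <= n.*2)%N -> cbin n <= s^-1.
Proof.
move=> Nn; have i0 : 0 <= s^-1 by rewrite invr_ge0 ltW.
have c0 := ltW (cbin_gt0 R n).
rewrite -ler_sqr ?nnegrE// exprVn sqr_s -[leRHS]mul1r ler_pdivlMr ?ltr0n//.
apply: le_trans (cbin_sqr_le R n); rewrite ler_wpM2l ?sqr_ge0// ler_nat; lia.
Qed.

Lemma cbin_le_quarter : cbin N <= 1 / 4.
Proof.
have sg := s_ge; apply: le_trans (cbin_le_inv_sqrt _) _; first by lia.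
by rewrite -[leRHS]invrK lef_pV2 ?posrE; lra.
Qed.

Lemma weight_bounds : 0 < weight N <= 2.
Proof.
have h := cbin_le_quarter; rewrite invr_gt0; apply/andP; split; first lra.
by rewrite -[leRHS]invrK lef_pV2 ?posrE; lra.
Qed.

Lemma sqr_weight_le : weight N ^+ 2 <= 4.
Proof. have /andP[? ?] := weight_bounds; nra. Qed.

(** The negative term is at most [4 * 2 / 16 = 1 / 2]. Nonnegativity makes the [m]-th power
    monotone. *)
Lemma pair_moment_ge0 a : 0 <= pair_moment N a.
Proof.
have h := cbin_le_quarter; have w4 := sqr_weight_le.
have w0 := sqr_ge0 (weight N); have p0 := cbin_gt0 R N.
have := mulr_gt0 (cbin_gt0 R a) (cbin_gt0 R (N - a)).
rewrite /pair_moment.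
move: (_ * _) (weight N ^+ 2) w4 w0 => y w *.
have : 0 <= w * y by rewrite mulr_ge0// ltW.
nra.
Qed.

Variables (m : nat).
Hypothesis m_le : m%:R <= s ^+ 3 / 32.

(** Apply [1 + z <= e^z] and [m * weight N ^+ 2 <= 4 * s^3 / 32]. *)
Lemma pair_moment_expn a y : 0 <= y ->
  cbin a * cbin (N - a) - 2 * cbin N ^+ 2 <= y ->
  pair_moment N a ^+ m <= expR (s ^+ 3 / 8 * y).
Proof.
move=> y0 hy; apply: (@le_trans _ _ (expR (weight N ^+ 2 * y) ^+ m)).
  apply: lerXn2r; rewrite ?nnegrE ?pair_moment_ge0 ?expR_ge0//.
  apply: le_trans _ (expR_ge1Dx _); by rewrite lerD2l ler_wpM2l// sqr_ge0.
rewrite -expRM_natl ler_expR.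
have w4 := sqr_weight_le; have w0 := sqr_ge0 (weight N).
have m0 : 0 <= m%:R :> R by rewrite ler0n.
have -> : s ^+ 3 / 8 * y = s ^+ 3 / 32 * (4 * y) by lra.
by apply: ler_pM => //; [rewrite mulr_ge0|rewrite ler_wpM2r].
Qed.

(** Up to the factor -2, the inner product of two sign vectors of length [2 N] that differ in [2 a]
    places. *)
Definition dev (a : nat) : R := (a.*2)%:R - N%:R.

Let devE a : (a <= N)%N -> dev a = a%:R - (N - a)%:R.
Proof. by move=> aN; rewrite /dev -addnn natrD natrB//; ring. Qed.

(** In [cbin_prod_le], [x = dev a ^+ 2 / s ^+ 4]; the main term cancels and leaves
    [2 * cbin N ^+ 2 * x], where [cbin N ^+ 2 <= s ^- 2]. *)
Lemma cbin_excess_le a : (a <= N)%N -> dev a ^+ 2 <= s ^+ 4 / 2 ->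
  cbin a * cbin (N - a) - 2 * cbin N ^+ 2 <= 2 * dev a ^+ 2 / s ^+ 6.
Proof.
move=> aN hd; have sp := s_gt0; have sg := s_ge.
have := @cbin_prod_le a (N - a); rewrite subnKC// -devE// => /(_ N_gt0) /=.
rewrite expr_div_n -sqr_s -exprM => h.
have := h _; rewrite ler_pdivrMr ?exprn_gt0// => {}h.
have {}h := h ltac:(lra).
have hp : cbin N ^+ 2 <= s ^- 2 by rewrite sqr_s cbin_sqr_le_inv.
have x0 : 0 <= dev a ^+ 2 / s ^+ 4 by apply: divr_ge0; [exact: sqr_ge0|exact/exprn_ge0/ltW].
rewrite [leRHS](_ : _ = 2 * s ^- 2 * (dev a ^+ 2 / s ^+ 4)); last first.
  by field; rewrite gt_eqF.
nra.
Qed.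

(** The exponent is at most [s^3 / 8 * 2 / s^3 = 1 / 4]. The window [|dev a| <= s^(3/2)] is far
    wider than the fluctuations of [dev], which are of order [s]. *)
Lemma pair_moment_typical a : (a <= N)%N -> dev a ^+ 2 <= s ^+ 3 ->
  pair_moment N a ^+ m <= 3 / 2.
Proof.
move=> aN hd; have sp := s_gt0; have sg := s_ge.
have y0 : 0 <= 2 * dev a ^+ 2 / s ^+ 6.
  by apply: divr_ge0; [apply: mulr_ge0 => //; exact: sqr_ge0|exact/exprn_ge0/ltW].
have hs : dev a ^+ 2 <= s ^+ 4 / 2.
  apply: le_trans hd _; rewrite (exprS _ 3).
  have : 0 < s ^+ 3 by rewrite exprn_gt0.
  nra.
apply: le_trans (pair_moment_expn y0 (cbin_excess_le aN hs)) _.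
apply: (@le_trans _ _ (expR (1 / 4))).
  rewrite ler_expR [leLHS](_ : _ = dev a ^+ 2 / s ^+ 3 / 4).
    by rewrite ler_pM2r// ler_pdivrMr ?exprn_gt0// mul1r.
  by field; rewrite gt_eqF.
have := expR_ge1Dx (- (1 / 4) : R).
by rewrite expRN -[leRHS]mul1r ler_pdivlMr ?expR_gt0//; lra.
Qed.

(** Up to [dev a ^+ 2 = s^4 / 2] the quadratic bound on the excess applies, with a factor [s] to
    spare. Beyond, the trivial bound [1 / s] gives the exponent [s^2 / 8], which is smaller than the
    one claimed. *)
Lemma pair_moment_atypical a : (a <= N)%N ->
  pair_moment N a ^+ m <= expR (dev a ^+ 2 / (4 * N%:R)).
Proof.
move=> aN; have sp := s_gt0; have sg := s_ge.
have [hd|hd] := leP (dev a ^+ 2) (s ^+ 4 / 2).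
  have y0 : 0 <= 2 * dev a ^+ 2 / s ^+ 6.
    by apply: divr_ge0; [apply: mulr_ge0 => //; exact: sqr_ge0|exact/exprn_ge0/ltW].
  apply: le_trans (pair_moment_expn y0 (cbin_excess_le aN hd)) _.
  rewrite ler_expR -sqr_s [leLHS](_ : _ = dev a ^+ 2 / (4 * s ^+ 2) / s).
    rewrite ler_pdivrMr// ler_peMr//; last lra.
    by apply: divr_ge0; [exact: sqr_ge0|apply: mulr_ge0 => //; exact: sqr_ge0].
  by field; rewrite gt_eqF.
have y0 : 0 <= s^-1 by rewrite invr_ge0 ltW.
have hy : cbin a * cbin (N - a) - 2 * cbin N ^+ 2 <= s^-1.
  have p2 : 0 <= cbin N ^+ 2 by rewrite sqr_ge0.
  suff : cbin a * cbin (N - a) <= s^-1 by lra.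
  have [a2|a2] := leqP N a.*2.
    by rewrite (le_trans _ (cbin_le_inv_sqrt a2))// ler_piMr ?cbin_le1 ?(ltW (cbin_gt0 _ _)).
  have b2 : (N <= (N - a).*2)%N by clear -aN a2; lia.
  by rewrite (le_trans _ (cbin_le_inv_sqrt b2))// ler_piMl ?cbin_le1 ?(ltW (cbin_gt0 _ _)).
apply: le_trans (pair_moment_expn y0 hy) _.
rewrite ler_expR -sqr_s ler_pdivlMr ?mulr_gt0 ?exprn_gt0//.
rewrite [leLHS](_ : _ = s ^+ 4 / 2); first exact: ltW.
by field; rewrite gt_eqF.
Qed.

Definition tail (j : nat) : R :=
  if (j%:R - N%:R) ^+ 2 <= s ^+ 3 then 0
  else expR ((j%:R - N%:R) ^+ 2 / (4 * N%:R)).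

Lemma pair_moment_le a : (a <= N)%N ->
  pair_moment N a ^+ m <= 3 / 2 + tail a.*2.
Proof.
move=> aN; rewrite /tail -/(dev a); case: ifPn => hd.
  by rewrite addr0 pair_moment_typical.
by rewrite (le_trans (pair_moment_atypical aN))// lerDr; lra.
Qed.

(** The left side is four times [2 N + 1], the number of terms in [sum_tail_le]. *)
Lemma expR_sqrt_ge : 8 * s ^+ 2 + 4 <= expR (s / 4).
Proof.
have sg := s_ge; have -> : s / 4 = 4%:R * (s / 16) by field.
rewrite expRM_natl; apply: (@le_trans _ _ ((s / 16) ^+ 4)).
  have -> : (s / 16) ^+ 4 = s ^+ 2 * (s / 256) ^+ 2 by field.
  have : 16 <= (s / 256) ^+ 2 by nra.
  have : 1 <= s ^+ 2 by nra.
  nra.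
apply: lerXn2r; rewrite ?nnegrE ?expR_ge0//; first lra.
by apply: le_trans _ (expR_ge1Dx _); lra.
Qed.

(** The Gaussian decay in [bin_gauss] has twice the exponent of the growth in [tail], so half of it
    survives; where [tail] is nonzero this half exceeds [s / 4]. *)
Lemma sum_tail_le :
  \sum_(j < N.*2.+1) 'C(N.*2, j)%:R * tail j <= 4 ^+ N / 4.
Proof.
have sp := s_gt0; have n0 : 0 < N%:R :> R by rewrite ltr0n.
have term (j : 'I_N.*2.+1) :
    'C(N.*2, j)%:R * tail j <= 4 ^+ N * expR (- (s / 4)).
  rewrite /tail; case: ifPn => [_|]; first by rewrite mulr0 mulr_ge0 ?expR_ge0 ?exprn_ge0.
  rewrite -ltNge => hd.
  have := @bin_gauss R N j N_gt0 (ltn_ord j : (j <= _)%N).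
  rewrite ler_pdivrMr ?exprn_gt0// => /ler_wpM2r h.
  apply: le_trans (h _ (expR_ge0 _)) _.
  rewrite [expR _ * _]mulrC -mulrA -expRD ler_wpM2l ?exprn_ge0// ler_expR.
  rewrite [leLHS](_ : _ = - ((j%:R - N%:R) ^+ 2 / (4 * N%:R))); last first.
    by field; rewrite gt_eqF.
  rewrite lerN2 ler_pdivlMr ?mulr_gt0// -sqr_s.
  have -> : s / 4 * (4 * s ^+ 2) = s ^+ 3 by field.
  by rewrite sqr_s ltW.
apply: le_trans (ler_sum _ (fun i _ => term i)) _.
rewrite sumr_const card_ord -[_ *+ N.*2.+1]mulr_natr -mulrA ler_wpM2l ?exprn_ge0//.
rewrite expRN mulrC ler_pdivrMr ?expR_gt0//.
have -> : N.*2.+1%:R = 2 * s ^+ 2 + 1 :> R by rewrite sqr_s -natr1 -mul2n natrM.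
by have := expR_sqrt_ge; lra.
Qed.

End Large.
End MomentBound.

(** * Counting subsets *)

Section SymmetricDifference.
Import fintype boot.finset.
Variable T : finType.
Implicit Types A B C W : {set T}.

(* A sign vector on W is encoded by the set of its +1 coordinates; the inner
   product of A and B is then |W| - 2 |symdiff A B|. *)
Definition symdiff A B : {set T} := [set x | (x \in A) (+) (x \in B)]%SET.

Lemma in_symdiff A B x : (x \in symdiff A B) = (x \in A) (+) (x \in B).
Proof. by rewrite inE. Qed.

Lemma symdiffK A : involutive (symdiff^~ A).
Proof. by move=> B; apply/setP => x; rewrite !in_symdiff addbK. Qed.

Lemma symdiffC A B : symdiff A B = symdiff B A.
Proof. by apply/setP => x; rewrite !in_symdiff addbC. Qed.

Lemma symdiffA A B C : symdiff A (symdiff B C) = symdiff (symdiff A B) C.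
Proof. by apply/setP => x; rewrite !in_symdiff addbA. Qed.

Lemma symdiff_sub W A B : A \subset W -> B \subset W -> symdiff A B \subset W.
Proof.
move=> /subsetP AW /subsetP BW; apply/subsetP => x; rewrite in_symdiff.
by case xA: (x \in A) => /=; [move=> _; exact: AW|exact: BW].
Qed.

Lemma symdiff_subE W A B : B \subset W ->
  (symdiff A B \subset W) = (A \subset W).
Proof.
move=> BW; apply/idP/idP => AW; last exact: symdiff_sub.
by rewrite -(symdiffK B A) symdiff_sub.
Qed.

Lemma card_symdiff A B : #|symdiff A B| = (#|A :\: B| + #|B :\: A|)%N.
Proof.
have -> : symdiff A B = (A :\: B) :|: (B :\: A).
  by apply/setP => x; rewrite !inE; case: (x \in A) (x \in B) => [] [].
rewrite cardsU (_ : _ :&: _ = set0) ?cards0 ?subn0//.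
by apply/setP => x; rewrite !inE; case: (x \in A) (x \in B) => [] [].
Qed.

Lemma odd_symdiff A B : odd #|symdiff A B| = odd #|A| (+) odd #|B|.
Proof.
rewrite card_symdiff -(cardsID B A) -(cardsID A B) setIC !oddD.
by case: (odd _) (odd _) (odd _) => [] [] [].
Qed.

(** Translation invariance in the group of subsets of [W]; it reduces a pair [u], [v] to the empty
    set and [symdiff u v]. *)
Lemma sum_symdiff (V : nmodType) W B (P : pred {set T}) (F : {set T} -> V) :
  B \subset W ->
  \sum_(A : {set T} | (A \subset W) && P (symdiff A B)) F (symdiff A B) =
  \sum_(A : {set T} | (A \subset W) && P A) F A.
Proof.
move=> BW; rewrite [RHS](reindex_inj (inv_inj (symdiffK B))).
by apply: eq_bigl => A; rewrite symdiff_subE.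
Qed.

(** Toggling a fixed element of [W] exchanges the two parities. *)
Lemma card_odd_subsets W (b : bool) : W != set0 ->
  (#|[set A : {set T} | (A \subset W) && (odd #|A| == b)]|%SET * 2 = 2 ^ #|W|)%N.
Proof.
move=> /set0Pn[x xW].
have xs : ([set x] \subset W)%SET by rewrite sub1set.
have flip : #|[set A : {set T} | (A \subset W) && (odd #|A| == b)]|%SET =
            #|[set A : {set T} | (A \subset W) && (odd #|A| == ~~ b)]|%SET.
  rewrite -[RHS](card_imset _ (inv_inj (symdiffK [set x]%SET))).
  apply: eq_card => A; rewrite inE; apply/idP/imsetP => [/andP[AW oA]|[B]].
    exists (symdiff A [set x]%SET); last by rewrite symdiffK.
    by rewrite inE symdiff_subE// AW odd_symdiff cards1 (eqP oA) addbT eqxx.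
  rewrite inE => /andP[BW oB] ->; rewrite symdiff_subE// BW.
  by rewrite odd_symdiff cards1 (eqP oB) addbT negbK eqxx.
rewrite muln2 -addnn {2}flip -card_powerset.
rewrite -(cardsID [set A : {set T} | odd #|A| == b]%SET (powerset W)).
congr (_ + _)%N; apply: eq_card => A; rewrite !inE;
  by case: (A \subset W) (odd _) (b) => [] [] [].
Qed.

(** The two conditions force [A] to have [a] elements in [B] and [N - a] in the rest of [W], and
    these two parts are chosen independently. *)
Lemma card_orthogonal_pair W (B : {set T}) (N a : nat) :
  #|W| = N.*2 -> B \subset W -> #|B| = a.*2 ->
  #|[set A : {set T} | (A \subset W) && ((#|A| == N) && (#|symdiff A B| == N))]|%SET
  = ('C(a.*2, a) * 'C((N - a).*2, N - a))%N.
Proof.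
move=> cW BW cB.
have aN : (a <= N)%N by have := subset_leq_card BW; lia.
have cWB : #|W :\: B| = (N - a).*2.
  by have := cardsID B W; rewrite (setIidPr BW); lia.
pose X := [set A : {set T} | A \subset B & #|A| == a]%SET.
pose Y := [set A : {set T} | A \subset W :\: B & #|A| == (N - a)%N]%SET.
have <- : #|finset.setX X Y| = ('C(a.*2, a) * 'C((N - a).*2, N - a))%N.
  by rewrite cardsX !cards_draws cB cWB.
pose f (p : {set T} * {set T}) := p.1 :|: p.2.
have split1 (x y : {set T}) : x \subset B -> y \subset W :\: B ->
    (x :|: y) :&: B = x /\ (x :|: y) :\: B = y.
  move=> /subsetP xB /subsetP yB; split; apply/setP => z;
    move/implyP: (xB z); move/implyP: (yB z); rewrite !inE;
    by case: (z \in x) (z \in y) (z \in B) (z \in W) => [] [] [] [].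
rewrite -(@card_in_imset _ _ f); last first.
  move=> [x y] [x' y']; rewrite !inE /f /= => /andP[/andP[xB _] /andP[yB _]].
  move=> /andP[/andP[x'B _] /andP[y'B _]] e.
  have [e1 e2] := split1 _ _ xB yB; have [e3 e4] := split1 _ _ x'B y'B.
  by congr (_, _); [rewrite -e1 e e3|rewrite -e2 e e4].
apply: eq_card => A; rewrite inE; apply/idP/imsetP.
  move=> /andP[AW /andP[/eqP cA /eqP]]; rewrite card_symdiff => cAB.
  have h1 := cardsID B A; have h2 := cardsID A B; rewrite setIC in h2.
  exists (A :&: B, A :\: B); last by rewrite /f /= setID.
  rewrite !inE /= subsetIr setSD//=.
  by apply/andP; split; apply/eqP; lia.
move=> [[x y]]; rewrite !inE /f /= => /andP[/andP[xB /eqP cx] /andP[yB /eqP cy]] ->.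
have [e1 e2] := split1 _ _ xB yB.
have h1 := cardsID B (x :|: y); have h2 := cardsID (x :|: y) B.
rewrite setIC e1 in h2; rewrite e1 e2 in h1.
rewrite subUset (fintype.subset_trans xB BW) (fintype.subset_trans yB (subsetDl _ _)) /=.
by rewrite card_symdiff e2; apply/andP; split; apply/eqP; lia.
Qed.

End SymmetricDifference.

(** * The second moment method *)

Section SecondMoment.
Import fintype boot.finset.
Variables (R : realType) (T : finType) (W : {set T}) (N m : nat) (s : R).
Hypotheses (card_W : #|W| = N.*2) (s_ge : 1024 <= s) (sqr_s : s ^+ 2 = N%:R).
Hypothesis m_le : m%:R <= s ^+ 3 / 32.
Local Notation p := (cbin R N).
Local Notation w := (weight R N).

Definition even_subset (u : {set T}) := (u \subset W) && ~~ odd #|u|.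

Let N_gt0 : (0 < N)%N.
Proof. by rewrite -(ltr0n R) -sqr_s exprn_gt0//; move: s_ge; lra. Qed.

Let W_neq0 : W != set0.
Proof. by rewrite -card_gt0 card_W double_gt0. Qed.

Let natr_card (P : pred {set T}) :
  \sum_(a : {set T} | a \subset W) (P a)%:R =
  #|[set a : {set T} | (a \subset W) && P a]|%:R :> R.
Proof.
rewrite (eq_bigr (fun a => if P a then 1 else 0)) => [|a _]; last by case: (P a).
by rewrite -big_mkcondr/= sumr_const; congr (_%:R); apply: eq_card => a; rewrite inE.
Qed.

(** * First and second moments of the weights of one row *)

Definition crit (a : {set T}) : R := (odd #|a| == odd N)%:R.
Definition orth (u a : {set T}) : R := (#|symdiff a u| == N)%:R.

(* Zero when the row [a] is orthogonal to the sign vector [u] on [W]. The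
   weight gives the rows of either parity the same mean: only those with
   [odd #|a| = odd N] can be orthogonal to an even [u]. *)
Definition row_weight (u a : {set T}) : R :=
  if #|symdiff a u| == N then 0 else if odd #|a| == odd N then w else 1.

Let orth_crit u a : even_subset u -> #|symdiff a u| = N -> odd #|a| = odd N.
Proof. by move=> /andP[_ /negbTE ou] <-; rewrite odd_symdiff ou addbF. Qed.

Let row_weightE u a : even_subset u ->
  row_weight u a = 1 + (w - 1) * crit a - w * orth u a.
Proof.
move=> eu; rewrite /row_weight /crit /orth.
case: (eqVneq #|symdiff a u| N) => [/(orth_crit eu) ->|_].
  by rewrite eqxx /=; ring.
by case: eqVneq => _ /=; ring.
Qed.

Let row_weightME u v a : even_subset u -> even_subset v ->
  row_weight u a * row_weight v a =
  1 + (w ^+ 2 - 1) * crit a - w ^+ 2 * orth u a - w ^+ 2 * orth v a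
  + w ^+ 2 * (orth u a * orth v a).
Proof.
move=> eu ev; rewrite /row_weight /crit /orth.
case: (eqVneq #|symdiff a u| N) => [/(orth_crit eu) ->|_].
  by rewrite eqxx /=; case: (#|symdiff a v| == N) => /=; ring.
case: (eqVneq #|symdiff a v| N) => [/(orth_crit ev) ->|_].
  by rewrite eqxx /=; ring.
by case: eqVneq => _ /=; ring.
Qed.

Let four_neq0 : (4 : R) ^+ N != 0.
Proof. by rewrite expf_neq0// pnatr_eq0. Qed.

Let sum_one : \sum_(a : {set T} | a \subset W) (1 : R) = 4 ^+ N.
Proof.
rewrite sumr_const (_ : #|_| = #|powerset W|).
  by rewrite card_powerset card_W -mul2n expnM natrX.
by apply: eq_card => a; rewrite inE.
Qed.

Let sum_odd b :
  \sum_(a : {set T} | a \subset W) (odd #|a| == b)%:R = 4 ^+ N / 2 :> R.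
Proof.
rewrite natr_card; have := card_odd_subsets b W_neq0.
rewrite card_W -mul2n expnM => /(congr1 (fun n => n%:R : R)).
by rewrite natrM natrX => <-; rewrite mulfK// pnatr_eq0.
Qed.

Let sum_orth (u : {set T}) : u \subset W ->
  \sum_(a : {set T} | a \subset W) orth u a = 4 ^+ N * p.
Proof.
move=> uW; have := @sum_symdiff _ R W u xpredT (fun a => (#|a| == N)%:R) uW.
rewrite /orth; under eq_bigl do rewrite andbT; move=> ->.
under eq_bigl do rewrite andbT.
by rewrite natr_card cards_draws card_W /cbin mulrCA mulfV ?mulr1.
Qed.

Let sum_orthM u v : even_subset u -> even_subset v ->
  let a := #|symdiff u v|./2 in
  \sum_(c : {set T} | c \subset W) orth u c * orth v c =
  4 ^+ N * (cbin R a * cbin R (N - a)).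
Proof.
move=> /andP[uW ou] /andP[vW ov] a.
have oB : ~~ odd #|symdiff u v| by rewrite odd_symdiff (negbTE ou) (negbTE ov).
have cB : #|symdiff u v| = a.*2 by rewrite /a even_halfK.
have BW : symdiff u v \subset W by apply: symdiff_sub.
have aN : (a <= N)%N by rewrite -leq_double -cB -card_W subset_leq_card.
have := @sum_symdiff _ R W u xpredT
  (fun c => (#|c| == N)%:R * (#|symdiff c (symdiff u v)| == N)%:R) uW.
under eq_bigl do rewrite andbT.
under eq_bigr do rewrite symdiffA symdiffK.
rewrite /orth => ->; under eq_bigl do rewrite andbT.
under eq_bigr do rewrite -natrM mulnb.
rewrite natr_card (card_orthogonal_pair card_W BW cB) natrM /cbin.
rewrite -[in 4 ^+ N](subnKC aN) exprD.
by field; rewrite !expf_neq0// pnatr_eq0.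
Qed.

Let weight_neq0 : 1 - 2 * p != 0.
Proof. by have := cbin_le_quarter s_ge sqr_s; lra. Qed.

(** Mean 1 is what determines the weight: [1 + (w - 1) / 2 - w p = 1] means [w = 1 / (1 - 2 p)]. *)
Lemma sum_row_weight u : even_subset u ->
  \sum_(a : {set T} | a \subset W) row_weight u a = 4 ^+ N.
Proof.
move=> eu; have /andP[uW _] := eu.
under eq_bigr do rewrite row_weightE//.
rewrite sumrB big_split/= -!big_distrr/= sum_one sum_odd sum_orth//.
by rewrite /weight; field.
Qed.

(** Since [w^2 (1 - 2 p)^2 = 1], the terms without [orth u a * orth v a] add up to
    [1 - 2 w^2 p^2]. *)
Lemma sum_row_weightM u v : even_subset u -> even_subset v ->
  \sum_(a : {set T} | a \subset W) row_weight u a * row_weight v a =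
  4 ^+ N * pair_moment R N #|symdiff u v|./2.
Proof.
move=> eu ev; have /andP[uW _] := eu; have /andP[vW _] := ev.
under eq_bigr do rewrite row_weightME//.
rewrite big_split/= !sumrB big_split/= -!big_distrr/= sum_one sum_odd !sum_orth//.
rewrite sum_orthM// /pair_moment /weight; field; exact: weight_neq0.
Qed.

Lemma sum1_even_subset :
  \sum_(u : {set T} | even_subset u) (1 : R) = 4 ^+ N / 2.
Proof.
rewrite -(sum_odd false) natr_card sumr_const; congr (_%:R).
by apply: eq_card => u; rewrite inE /even_subset eqbF_neg.
Qed.

(** The [4^N / 2] even subsets contribute at most [3 / 2] each, and the tails at most [4^N / 4] in
    total, even when summed over all subsets of [W]. *)
Lemma sum_pair_moment :
  \sum_(u : {set T} | even_subset u) pair_moment R N #|u|./2 ^+ m <= 4 ^+ N.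
Proof.
have st := sum_tail_le s_ge sqr_s.
apply: (@le_trans _ _ (\sum_(u : {set T} | even_subset u) (3 / 2 + tail N s #|u|))).
  apply: ler_sum => u /andP[uW ou].
  have := @pair_moment_le _ _ _ s_ge sqr_s _ m_le #|u|./2.
  rewrite even_halfK//; apply.
  by rewrite -leq_double even_halfK// -card_W subset_leq_card.
rewrite big_split/=; apply: (@le_trans _ _ (4 ^+ N * (3 / 4) + 4 ^+ N / 4)); last lra.
apply: lerD.
  by rewrite -[3 / 2]mulr1 -big_distrr/= sum1_even_subset; lra.
apply: le_trans st.
apply: (@le_trans _ _ (\sum_(u : {set T} | u \subset W) tail N s #|u|)).
  rewrite [leRHS](bigID (fun u : {set T} => ~~ odd #|u|))/= lerDl sumr_ge0// => u _.
  by rewrite /tail; case: ifP => // _; exact: expR_ge0.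
rewrite (partition_big (fun u : {set T} => inord #|u| : 'I_N.*2.+1) xpredT)//=.
apply: ler_sum => j _.
rewrite (eq_bigl (mem [set u : {set T} | (u \subset W) && (#|u| == j)])); last first.
  move=> u /=; rewrite inE; case uW: (u \subset W) => //=.
  have cu := subset_leq_card uW; rewrite card_W in cu.
  by rewrite -(inj_eq val_inj) /= inordK.
rewrite (eq_bigr (fun=> tail N s j)) => [|u]; last by rewrite /= inE => /andP[_ /eqP ->].
by rewrite sumr_const cards_draws card_W mulr_natl.
Qed.

(** A weighted count of the even sign vectors on [W] that are orthogonal to no row. *)
Let count (A : {ffun 'I_m -> {set T}}) : R :=
  \sum_(u : {set T} | even_subset u) \prod_i row_weight u (A i).

Let rows (A : {ffun 'I_m -> {set T}}) := [forall i, A i \subset W].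

Let sum_rows (F : {set T} -> R) :
  \sum_(A | rows A) \prod_i F (A i) =
  (\sum_(a : {set T} | a \subset W) F a) ^+ m.
Proof.
rewrite -[in RHS](card_ord m) -prodr_const bigA_distr_big.
by apply: eq_bigl => A; apply/forallP/ffun_onP.
Qed.

Lemma sum_count : \sum_(A | rows A) count A = 4 ^+ N / 2 * (4 ^+ N) ^+ m.
Proof.
rewrite exchange_big/= -sum1_even_subset big_distrl/=; apply: eq_bigr => u eu.
by rewrite mul1r -[in RHS](sum_row_weight eu) sum_rows.
Qed.

(** The second moment is at most twice the square of the mean [4^N / 2]: for each fixed [u],
    translation by [u] turns the sum over [v] into that of [sum_pair_moment]. *)
Lemma sum_sqr_count :
  \sum_(A | rows A) count A ^+ 2 <= 4 ^+ N / 2 * 4 ^+ N * (4 ^+ N) ^+ m.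
Proof.
rewrite (eq_bigr (fun A : {ffun 'I_m -> {set T}} =>
    \sum_(u : {set T} | even_subset u) \sum_(v : {set T} | even_subset v)
      \prod_i (row_weight u (A i) * row_weight v (A i)))); last first.
  move=> A _; rewrite expr2 big_distrlr/=; apply: eq_bigr => u _.
  by apply: eq_bigr => v _; rewrite big_split.
rewrite exchange_big/= -sum1_even_subset -mulrA big_distrl/=.
apply: ler_sum => u eu; rewrite mul1r exchange_big/=.
rewrite (eq_bigr (fun v : {set T} =>
    pair_moment R N #|symdiff v u|./2 ^+ m * (4 ^+ N) ^+ m)); last first.
  move=> v ev; rewrite -exprMn [_ * 4 ^+ N]mulrC symdiffC -(sum_row_weightM eu ev).
  exact: (sum_rows (fun a => row_weight u a * row_weight v a)).
rewrite -big_distrl/= ler_wpM2r ?exprn_ge0//.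
apply: le_trans sum_pair_moment.
have /andP[uW ou] := eu.
have := @sum_symdiff _ R W u (fun v => ~~ odd #|v|)
  (fun v => pair_moment R N #|v|./2 ^+ m) uW.
rewrite -/(even_subset _) => <-.
rewrite le_eqVlt; apply/orP; left; apply/eqP; apply: eq_bigl => v.
by rewrite /even_subset odd_symdiff (negbTE ou) addbF.
Qed.

(** A variable whose second moment is at most twice its squared mean is nonzero with probability at
    least 1/2. The number [t] below is the mean divided by the bound on the second moment. *)
Lemma many_nonorthogonal :
  (4 ^+ N) ^+ m / 2 <=
  #|[set A : {ffun 'I_m -> {set T}} | [forall i, A i \subset W] &&
     [exists u : {set T}, (u \subset W) && [forall i, #|symdiff (A i) u| != N]]]|%:R
  :> R.
Proof.
set G := [set _ | _].
have Z A : count A != 0 ->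
    [exists u : {set T}, (u \subset W) && [forall i, #|symdiff (A i) u| != N]].
  apply: contraNT; rewrite negb_exists => /forallP h; apply/eqP.
  apply: big1 => u /andP[uW _]; have := h u.
  rewrite uW negb_forall/= => /existsP[i]; rewrite negbK => e.
  by rewrite (bigD1 i)//= /row_weight e mul0r.
pose t : R := (4 ^+ N)^-1.
(* [1_{z <> 0} >= 2 t z - t^2 z^2], summed with the optimal [t]. *)
apply: (@le_trans _ _ (\sum_(A | rows A) (2 * t * count A - t ^+ 2 * count A ^+ 2))).
  rewrite sumrB -!big_distrr/= sum_count.
  apply: (@le_trans _ _ (2 * t * (4 ^+ N / 2 * (4 ^+ N) ^+ m) -
      t ^+ 2 * (4 ^+ N / 2 * 4 ^+ N * (4 ^+ N) ^+ m))).
    rewrite le_eqVlt; apply/orP; left; apply/eqP; rewrite /t.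
    by field; rewrite four_neq0.
  by rewrite lerD2l lerN2 ler_wpM2l ?sqr_ge0 ?sum_sqr_count.
rewrite -sum1_card natr_sum [leRHS](eq_bigl (fun A => rows A && (A \in G))); last first.
  by move=> A; rewrite inE /rows; case: [forall i, _].
rewrite [leRHS]big_mkcondr/=; apply: ler_sum => A rA.
case: ifPn => [_|]; first by have := sqr_ge0 (1 - t * count A); nra.
by rewrite inE -/(rows A) rA => /(contraNN (@Z A))/negbNE/eqP ->; lra.
Qed.

End SecondMoment.

(** * From sign patterns to random matrices *)

Section SignVectors.
Import fintype boot.finset.
Variable R : realType.

Lemma sparse_set_unimodular (n k : nat) (x : 'cV[R]_n) : x != 0 ->
  (#|supp x| <= k)%N -> (forall i, i \in supp x -> `|x i 0| = 1) ->
  sparse_set k 1 x.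
Proof.
move=> x0 xk x1; split=> //.
have [i0 i0x] : exists i, i \in supp x.
  apply/existsP; apply: contraNT x0; rewrite negb_exists => /forallP h.
  apply/eqP/matrixP => i j; rewrite ord1 mxE.
  by have := h i; rewrite inE negbK => /eqP.
have max1 : max_supp x = 1.
  apply/eqP; rewrite eq_le; apply/andP; split.
    by apply: bigmax_le => // i /x1 ->.
  by rewrite -(x1 _ i0x); apply: le_bigmax_cond.
have min1 : min_supp x = 1.
  rewrite /min_supp max1; elim/big_ind : _ => // _ _ -> ->.
  exact: minxx.
by rewrite max1 min1 divr1.
Qed.

Lemma sum_sign_symdiff (T : finType) (W A B : {set T}) : A \subset W ->
  B \subset W ->
  \sum_(j in W) (if j \in A then 1 else -1) * (if j \in B then 1 else -1) =
  #|W|%:R - 2 * #|symdiff A B|%:R :> R.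
Proof.
move=> AW BW.
rewrite (eq_bigr (fun j => 1 - 2 * (j \in symdiff A B)%:R)); last first.
  move=> j _; rewrite in_symdiff.
  by case: (j \in A) (j \in B) => [] [] /=; ring.
rewrite sumrB sumr_const -big_distrr/=; congr (_ - 2 * _).
rewrite -[in RHS]sum1_card natr_sum.
rewrite (eq_bigr (fun j => if j \in symdiff A B then 1 else 0)); last first.
  by move=> j _; case: (j \in _).
rewrite -big_mkcondr/=; apply: eq_bigl => j.
case jS: (j \in symdiff A B); last by rewrite andbF.
by rewrite (subsetP (symdiff_sub AW BW)).
Qed.

Lemma sign1_perturb (x e : R) : `|e| <= 1 -> 2 <= `|x| -> sign1 (x + e) = sign1 x.
Proof.
rewrite /sign1 ler_norml => /andP[e1 e2]; rewrite ler_normr => x2.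
have [x0|x0] := leP 0 x.
  by rewrite ifT//; case/orP: x2 => x2; lra.
by rewrite ifF//; apply/negbTE; rewrite -ltNge; case/orP: x2 => x2; lra.
Qed.

(** The witnesses are the sign vector of [u] on [W] and its extension by 1 at [z], which [N.*2 < k]
    keeps sparse. Row [i] has inner product [2 (N - #|symdiff (S i) u|)] with the first, of modulus
    at least 2, so adding [A i z] preserves the sign. *)
Lemma not_valid_of_nonorthogonal (m n k N : nat) (A : 'M[R]_(m, n))
    (W u : {set 'I_n}) (S : 'I_m -> {set 'I_n}) (z : 'I_n) :
  (0 < N)%N -> (N.*2 < k)%N -> #|W| = N.*2 -> z \notin W -> u \subset W ->
  (forall i, `|A i z| <= 1) ->
  (forall i, S i \subset W) ->
  (forall i j, j \in W -> A i j = if j \in S i then 1 else -1) ->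
  (forall i, #|symdiff (S i) u| != N) ->
  ~ valid_universal_1bit k 1 A.
Proof.
move=> N0 Nk cW zW uW Az SW AS Su valid.
pose x : 'cV[R]_n :=
  \col_j (if j \in W then if j \in u then 1 else -1 else 0).
pose y : 'cV[R]_n := x + delta_mx z 0.
have xW j : j \in W -> `|x j 0| = 1.
  by move=> jW; rewrite mxE jW; case: ifP; rewrite ?normrN normr1.
have suppx : supp x = W.
  apply/setP => j; rewrite inE; have [/xW jW|jW] := boolP (j \in W).
    by rewrite -normr_gt0 jW ltr01.
  by rewrite mxE (negbTE jW) eqxx.
have yz : y z 0 = 1 by rewrite !mxE (negbTE zW) !eqxx add0r.
have yW j : j != z -> y j 0 = x j 0.
  by move=> jz; rewrite !mxE (negbTE jz) addr0.
have suppy : supp y = z |: W.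
  apply/setP => j; rewrite !inE; have [->|jz] := eqVneq j z.
    by rewrite yz oner_eq0.
  by rewrite yW//= -[in RHS]suppx inE.
have nz v : supp v != set0 -> v != 0 :> 'cV[R]_n.
  apply: contraNneq => ->; apply/eqP/setP => j.
  by rewrite !inE mxE eqxx.
have Ax i : (A *m x) i 0 = N.*2%:R - 2 * #|symdiff (S i) u|%:R.
  rewrite mxE -cW -(sum_sign_symdiff (SW i) uW) [RHS]big_mkcond.
  apply: eq_bigr => j _; rewrite !mxE; case: ifPn => [jW|]; last by rewrite mulr0.
  by rewrite AS.
have Ay i : (A *m y) i 0 = (A *m x) i 0 + A i z.
  rewrite mulmxDr mxE; congr (_ + _); rewrite mxE (bigD1 z)//= big1 => [|j jz].
    by rewrite mxE !eqxx mulr1 addr0.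
  by rewrite mxE (negbTE jz) mulr0.
apply: (valid x y).
- apply: sparse_set_unimodular; rewrite ?nz ?suppx ?cW//; last by lia.
    by rewrite -card_gt0 cW double_gt0.
- apply: sparse_set_unimodular; rewrite ?nz ?suppy//.
  + by apply/set0Pn; exists z; rewrite !inE eqxx.
  + by rewrite cardsU1 zW cW.
  + move=> j; rewrite !inE; have [->|jz] := eqVneq j z; first by rewrite yz normr1.
    by move=> /= jW; rewrite yW// xW.
- rewrite suppx suppy; apply: contraNneq zW => ->.
  by rewrite !inE eqxx.
apply/matrixP => i j; rewrite ord1 ![signv _ _ _]mxE Ay sign1_perturb//.
rewrite Ax; have := Su i; rewrite neq_ltn => hS; rewrite -mul2n natrM -mulrBr normrM.
rewrite (ger0_norm (_ : 0 <= 2))// ler_peMr// ler_normr.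
case/orP: hS => h.
  have : #|symdiff (S i) u|.+1%:R <= N%:R :> R by rewrite ler_nat.
  by rewrite -natr1 => ?; apply/orP; left; lra.
have : N.+1%:R <= #|symdiff (S i) u|%:R :> R by rewrite ler_nat.
by rewrite -natr1 => ?; apply/orP; right; lra.
Qed.

End SignVectors.

(** * Probability and measurability of events on sign matrices *)

Section RandomSigns.
Context (d : measure_display) (T : measurableType d) (R : realType)
  (P : probability T R).

Lemma measure_bigcup_fin (I : finType) (G : {set I}) (F : I -> set T) :
  (forall i, measurable (F i)) -> trivIset [set` G] F ->
  P (\bigcup_(i in [set` G]) F i)%classic = (\sum_(i in G) P (F i))%E.
Proof.
move=> mF tF; rewrite measure_fin_bigcup//.
rewrite -[RHS]big_enum [RHS]fsbig_seq ?enum_uniq//.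
have -> // : [set` enum G]%classic = [set` G]%classic.
by apply/seteqP; split => i /=; rewrite mem_enum.
Qed.

Variables (m n : nat) (a : 'I_m -> 'I_n -> {RV P >-> R}).
Hypothesis rad : forall i j, rademacher (a i j).

Definition sign_pattern (J : {set 'I_m * 'I_n}) (b : 'I_m * 'I_n -> bool) : set T :=
  (\bigcap_(ij in [set` J]) (a ij.1 ij.2 @^-1` [set if b ij then 1 else -1]))%classic.

Lemma measurable_sign_pattern J b : measurable (sign_pattern J b).
Proof. exact: fin_bigcap_measurable. Qed.

Lemma prob_sign_pattern J b :
  mutually_independent (fun ij : 'I_m * 'I_n => a ij.1 ij.2) ->
  P (sign_pattern J b) = ((1 / 2) ^+ #|J|)%:E.
Proof.
move=> /(_ J (fun ij => [set if b ij then 1 else -1]%classic))->//.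
rewrite -prodr_const -prodEFin; apply: eq_bigr => ij _.
by have [_ h1 h2] := rad ij.1 ij.2; case: (b ij).
Qed.

(** Validity quantifies over real vectors, but the matrix takes finitely many values, so the event
    is a finite union of full sign patterns. *)
Lemma measurable_not_valid (k : nat) (rho : R) :
  measurable [set w | ~ valid_universal_1bit k rho (random_matrix a w)]%classic.
Proof.
pose M (b : {ffun 'I_m * 'I_n -> bool}) : 'M[R]_(m, n) :=
  \matrix_(i, j) (if b (i, j) then 1 else -1).
rewrite [X in measurable X](_ : _ =
  \bigcup_(b in [set b | ~ valid_universal_1bit k rho (M b)])
    sign_pattern finset.setT b)%classic.
  by apply: fin_bigcup_measurable => // b _; exact: measurable_sign_pattern.
have MP w (b : {ffun 'I_m * 'I_n -> bool}) :
    sign_pattern finset.setT b w -> random_matrix a w = M b.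
  move=> wb; apply/matrixP => i j; rewrite !mxE.
  by have := wb (i, j); rewrite /= inE => /(_ isT).
apply/seteqP; split => w /=.
  move=> nv; pose b : {ffun 'I_m * 'I_n -> bool} := [ffun ij => a ij.1 ij.2 w == 1].
  have wb : sign_pattern finset.setT b w.
    move=> ij _ /=; rewrite ffunE.
    have [h _ _] := rad ij.1 ij.2; have [->|->] := h w; first by rewrite eqxx.
    by rewrite ifF//; apply/negbTE; rewrite lt_eqF//; lra.
  by exists b => //=; rewrite -(MP _ _ wb).
by move=> [b /= nv wb]; rewrite (MP _ _ wb).
Qed.

End RandomSigns.

(** Take for [W] the first [2 N] columns and for [z] the next one. The patterns of the rows on [W]
    are disjoint events of probability [4^(-N m)], and [many_nonorthogonal] says that at least half
    of them are bad. *)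
Lemma not_valid_prob_ge (R : realType) (m n k N : nat) (s : R) :
  1024 <= s -> s ^+ 2 = N%:R -> m%:R <= s ^+ 3 / 32 ->
  (N.*2 < k)%N -> (N.*2 < n)%N ->
  forall (d : measure_display) (T : measurableType d) (P : probability T R)
    (a : 'I_m -> 'I_n -> {RV P >-> R}),
  (forall i j, rademacher (a i j)) ->
  mutually_independent (fun ij : 'I_m * 'I_n => a ij.1 ij.2) ->
  ((1 / 2)%:E <=
     P [set w | ~ valid_universal_1bit k 1 (random_matrix a w)]%classic)%E.
Proof.
move=> s_ge sqr_s m_le Nk Nn d T P a rad indep.
have N0 : (0 < N)%N by rewrite -(ltr0n R) -sqr_s exprn_gt0//; lra.
pose W := [set j : 'I_n | (j < N.*2)%N]%SET.
have cW : #|W| = N.*2.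
  rewrite cardsE -sum1_card -(big_ord_widen n (fun=> 1%N)) ?(ltnW Nn)//.
  by rewrite sum_nat_const card_ord muln1.
have zW : Ordinal Nn \notin W by rewrite inE /= ltnn.
have := many_nonorthogonal cW s_ge sqr_s m_le.
set G := [set _ | _]%SET => many.
pose J := [set ij : 'I_m * 'I_n | ij.2 \in W]%SET.
have cJ : #|J| = (m * N.*2)%N.
  have -> : J = finset.setX finset.setT W by apply/setP => -[i j]; rewrite !inE.
  by rewrite cardsX cardsT card_ord cW.
pose E (S : {ffun 'I_m -> {set 'I_n}}) :=
  sign_pattern a J (fun ij => ij.2 \in S ij.1).
have ES S w i j : E S w -> j \in W -> a i j w = if j \in S i then 1 else -1.
  by move=> wS jW; have := wS (i, j); rewrite /= inE => /(_ jW).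
have inG S : S \in G -> forall i, S i \subset W.
  by rewrite inE => /andP[/forallP].
have mE S : measurable (E S) by exact: measurable_sign_pattern.
apply: (@le_trans _ _ (P (\bigcup_(S in [set` G]) E S)%classic)); last first.
  apply: le_measure; rewrite ?inE.
  - by apply: fin_bigcup_measurable.
  - exact: measurable_not_valid.
  move=> w [S /= SG wS]; have := SG.
  rewrite inE => /andP[_ /existsP[u /andP[uW /forallP Su]]].
  apply: (not_valid_of_nonorthogonal N0 Nk cW zW uW) Su; last 2 first.
  - exact: inG.
  - by move=> i j jW; rewrite mxE (ES S).
  move=> i; rewrite mxE; have [h _ _] := rad i (Ordinal Nn).
  by have [->|->] := h w; rewrite ?normrN normr1.
rewrite measure_bigcup_fin//; last first.
  move=> S S' /= SG S'G [w [wS wS']]; apply/ffunP => i; apply/setP => j.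
  have [jW|jW] := boolP (j \in W).
    have := ES S w i j wS jW; rewrite (ES S' w i j wS' jW).
    by case: (j \in S i) (j \in S' i) => [] [] // h; exfalso; lra.
  transitivity false; [apply/negbTE|apply/esym/negbTE];
    apply: contraNN jW; exact/fintype.subsetP/inG.
rewrite (eq_bigr (fun=> ((1 / 2) ^+ (m * N.*2))%:E)); last first.
  by move=> S _; rewrite prob_sign_pattern// cJ.
rewrite sumEFin lee_fin sumr_const -[leRHS]mulr_natl.
have -> : (1 / 2 : R) ^+ (m * N.*2) = ((4 ^+ N) ^+ m)^-1.
  by rewrite mulnC exprM -mul2n exprM -!exprVn; congr ((_ ^+ _) ^+ _); field.
by rewrite ler_pdivlMr ?exprn_gt0// mul1r mulrC.
Qed.

Theorem theorem4 (R : realType) (eps : R) (eps_gt0 : 0 < eps) (eps_lt : eps < 2 / 3) :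
  exists2 c : R, 0 < c &
    forall (n k m : nat), (0 < n)%N -> (0 < k)%N -> (0 < m)%N ->
    k%:R <= n%:R `^ (2 / 3 - eps) ->
    m%:R <= c * k%:R `^ (3 / 2) ->
    forall (d : measure_display) (T : measurableType d) (P : probability T R)
      (a : 'I_m -> 'I_n -> {RV P >-> R}),
    (forall i j, rademacher (a i j)) ->
    mutually_independent (fun ij : 'I_m * 'I_n => a ij.1 ij.2) ->
    ((1 / 2)%:E <=
       P [set w | ~ valid_universal_1bit k 1 (random_matrix a w)]%classic)%E.
Proof.
(* Abstracted because [2048 : R] unfolds to a sum of 2048 ones, which [done]
   would try to compute with. *)
have [K K_eq] : exists K : R, K = 2048 by exists 2048.
have K_gt0 : 0 < K by lra.
(* The bound on [m] becomes [m <= (sqrt k / 2048)^3]; as [m >= 1], it forces [sqrt k >= 2048], so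
   that [N] is large. *)
exists (K ^- 3); first by rewrite invr_gt0 exprn_gt0.
move=> n k m n0 k0 m0 kn mk.
(* The largest [N] with [2 N < k], leaving one coordinate for [z]. *)
pose N := (k.-1)./2.
have Nk : (N.*2 < k)%N by clear -k0; lia.
have kN : (k <= 2 * N + 2)%N by clear; lia.
(* As [2 / 3 - eps <= 1], the sparsity bound gives [k <= n], hence a column outside [W]. *)
have nk : (k <= n)%N.
  rewrite -(ler_nat R); apply: le_trans kn _.
  rewrite -[leRHS]powRr1 ?ler0n// ler_powR ?ler1n//; lra.
pose y : R := Num.sqrt k%:R.
have y0 : 0 <= y by exact: sqrtr_ge0.
have sqr_y : y ^+ 2 = k%:R by rewrite sqr_sqrtr.
have {}mk : m%:R <= y ^+ 3 / K ^+ 3.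
  rewrite mulrC; apply: le_trans mk _; rewrite ler_pM2l ?invr_gt0 ?exprn_gt0//.
  have -> : (3 / 2 : R) = 2^-1 * 3%:R by rewrite mulrC.
  by rewrite powRrM powR12_sqrt// powR_mulrn.
have y_ge : K <= y.
  rewrite leNgt; apply/negP => y_lt.
  have : (1 : R) <= m%:R by rewrite ler1n.
  apply/negP; rewrite -ltNge; apply: le_lt_trans mk _.
  by rewrite ltr_pdivrMr ?exprn_gt0// mul1r ltrXn2r// ltW.
pose s : R := Num.sqrt N%:R.
have s0 : 0 <= s by exact: sqrtr_ge0.
have sqr_s : s ^+ 2 = N%:R by rewrite sqr_sqrtr.
have ys2 : y ^+ 2 <= 2 * s ^+ 2 + 2 by rewrite sqr_y sqr_s -[2 * _]natrM -natrD ler_nat.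
have s_ge : 1024 <= s by nra.
apply: (@not_valid_prob_ge _ _ _ _ N s) => //.
- apply: le_trans mk _.
  have ys : y <= 2 * s by nra.
  have : y ^+ 3 <= (2 * s) ^+ 3 by apply: lerXn2r; rewrite ?nnegrE//; lra.
  have : 0 <= s ^+ 3 by rewrite exprn_ge0.
  by rewrite exprMn K_eq; lra.
- exact: leq_trans Nk nk.
Qed.
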